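(* Let $A$ be a torsion-free abelian group and $(A,(\cdot,\cdot),R)$ a tame irreducible affine reflection system of type $A_1$ with $R^0\neq\{0\}$, with Weyl group $\mathcal{W}$ and hyperbolic Weyl group $\widetilde{\mathcal{W}}$. Let $w:=w_{\alpha_1}\cdots w_{\alpha_k}$ with $\alpha_1,\dots,\alpha_k\in R^\times$. The following statements are equivalent: (i) $(\alpha_1,\ldots,\alpha_k)\in\mathrm{Alt}(R^\times)$; (ii) $w=1$ in $\mathcal{W}$ (or equivalently $w|_{\mathcal{V}}=\mathrm{id}_{\mathcal{V}}$); (iii) if $w=w_{\beta_1}\cdots w_{\beta_m}$ with $\beta_1,\dots,\beta_m\in R^\times$, then $(\beta_1,\ldots,\beta_m)\in\mathrm{Alt}(R^\times)$; (iv) $w\in Z(\widetilde{\mathcal{W}})$, the center of $\widetilde{\mathcal{W}}$.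
   Context: A product $w_{\alpha_1}\cdots w_{\alpha_k}$ ($\alpha_i\in R^\times$) is regarded as an element of $\mathcal{W}$ or of $\widetilde{\mathcal{W}}$ depending on the context; in (iii) and (iv) it is regarded as an element of $\widetilde{\mathcal{W}}$. Let $A$ be a torsion-free abelian group with a nontrivial symmetric positive semidefinite bi-homomorphism $(\cdot,\cdot):A\times A\to\mathbb{Q}$, with radical $A^0=\{\alpha\in A:(\alpha,A)=0\}$. For $B\subseteq A$ put $B^\times=B\setminus A^0$, $B^0=B\cap A^0$. Put $(\beta,\alpha^\vee)=2(\beta,\alpha)/(\alpha,\alpha)$ if $(\alpha,\alpha)\neq0$ and $(\beta,\alpha^\vee)=0$ otherwise. A subset $R\subseteq A$ is an affine reflection system if (R1) $R=-R$; (R2) $R$ generates $A$; (R3) for $\alpha\in R^\times$, $\beta\in R$ there are $d,u\in\mathbb{Z}_{\ge0}$ with $(\beta+\mathbb{Z}\alpha)\cap R=\{\beta-d\alpha,\dots,\beta+u\alpha\}$ and $d-u=(\beta,\alpha^\vee)$. It is irreducible if $R^\times$ is not a disjoint union of two nonempty orthogonal subsets, and tame if $R^0\subseteq R^\times-R^\times$. Its type is the type of its image in $A/A^0$ (a locally finite root system); type $A_1$ means that this image is $\{0,\pm\bar\epsilon\}$. For $R$ tame irreducible of type $A_1$ it is known that $R=(S+S)\cup(\dot R+S)$ with $\dot R=\{0,\pm\epsilon\}$, $S\subseteq R^0$, $0\in S$, $S\pm2S\subseteq S$, $\langle S\rangle=A^0$, and $A=\mathbb{Z}\epsilon\oplus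 A^0$. Fix such $\epsilon$, $S$, normalized so that $(\epsilon,\epsilon)=2$. For $\alpha\in A$ write $\alpha=\mathrm{sgn}(\alpha)\epsilon+p(\alpha)$ with $\mathrm{sgn}(\alpha)\in\mathbb{Z}$, $p(\alpha)\in A^0$. The Weyl group $\mathcal{W}$ of $R$ is the subgroup of $\mathrm{Aut}(A)$ generated by all $w_\alpha(\beta)=\beta-(\beta,\alpha^\vee)\alpha$, $\alpha\in R$. $\mathrm{Alt}(R^\times)$ is the set of all tuples $(\alpha_1,\dots,\alpha_k)$ of elements of $R^\times$ (all $k$) with $k$ even and $\sum_{j=1}^k(-1)^j\mathrm{sgn}(\alpha_j)p(\alpha_j)=0$. Let $\mathcal{V}=\mathbb{Q}\otimes_{\mathbb{Z}}A$ with the extended form; identify $A$, $R$ with subsets of $\mathcal{V}$. Let $\mathcal{V}^0=\mathbb{Q}\otimes A^0$, so $\mathcal{V}=\mathbb{Q}\epsilon\oplus\mathcal{V}^0$. Fix a basis $\{\sigma_j\mid j\in J\}\subseteq S$ of $\mathcal{V}^0$; let $\lambda_j\in(\mathcal{V}^0)^\star$ be given by $\lambda_j(\sigma_i)=\delta_{ij}$, and $(\mathcal{V}^0)^\dagger=\sum_{j\in J}\mathbb{Q}\lambda_j$. Put $\widetilde{\mathcal{V}}=\mathcal{V}\oplus(\mathcal{V}^0)^\dagger$ and extend the form to a symmetric bilinear form on $\widetilde{\mathcal V}$ by $(\epsilon,(\mathcal{V}^0)^\dagger)=((\mathcal{V}^0)^\dagger,(\mathcal{V}^0)^\dagger)=0$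 and $(\sigma,\lambda)=\lambda(\sigma)$ for $\sigma\in\mathcal{V}^0$, $\lambda\in(\mathcal{V}^0)^\dagger$. For $\alpha\in\mathcal{V}$ let $w_\alpha\in\mathrm{Aut}(\widetilde{\mathcal{V}})$, $w_\alpha(\beta)=\beta-(\beta,\alpha^\vee)\alpha$ (same convention for $\alpha^\vee$). The hyperbolic Weyl group $\widetilde{\mathcal{W}}$ is the subgroup of $\mathrm{Aut}(\widetilde{\mathcal{V}})$ generated by $w_\alpha$, $\alpha\in R$. *)

(* Defs.v *)
From HB Require Import structures.
From mathcomp Require Export all_boot all_order all_algebra.
From mathcomp Require Export boolp classical_sets functions.
From mathcomp Require Import zify ring.

Set Implicit Arguments.
Unset Strict Implicit.
Unset Printing Implicit Defensive.

Import Order.TTheory GRing.Theory Num.Theory.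
Local Open Scope quotient_scope.
Local Open Scope classical_set_scope.
Local Open Scope ring_scope.

(* The Q-vector space Q (x)_Z A of an abelian group A, realized as the         *)
(* localization of A at the positive integers: a pair (a, n) stands for the   *)
(* element 1/(n+1) (x) a.  No torsion hypothesis on A is needed; the           *)
(* universal property is proved in rat_tensor_univ.                            *)
Section RatTensor.
Variable A : zmodType.
Implicit Types x y z : A * nat.

Definition rt_rel x y : bool :=
  `[< exists2 k : nat, (0 < k)%N &
      x.1 *~ (y.2.+1%:Z * k%:Z) = y.1 *~ (x.2.+1%:Z * k%:Z) >].

Fact rt_rel_refl : reflexive rt_rel.
Proof. by move=> x; apply/asboolP; exists 1%N. Qed.

Fact rt_rel_sym : symmetric rt_rel.
Proof. by move=> x y; apply/asboolP/asboolP => -[k k0 e]; exists k. Qed.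

Fact rt_rel_trans : transitive rt_rel.
Proof.
move=> [b m] [a n] [c l] /asboolP[/= k k0 e1] /asboolP[/= k' k'0 e2].
apply/asboolP; exists (m.+1 * k * k')%N => /=; first by rewrite !muln_gt0 k0.
transitivity (a *~ (m.+1%:Z * k%:Z) *~ (l.+1%:Z * k'%:Z)).
  by rewrite -mulrzA !PoszM; congr (_ *~ _); ring.
rewrite e1 -mulrzA.
transitivity (b *~ (l.+1%:Z * k'%:Z) *~ (n.+1%:Z * k%:Z)).
  by rewrite -mulrzA; congr (_ *~ _); ring.
by rewrite e2 -mulrzA !PoszM; congr (_ *~ _); ring.
Qed.

Canonical rt_equiv := EquivRel rt_rel rt_rel_refl rt_rel_sym rt_rel_trans.

Definition rat_tensor := {eq_quot rt_rel}.
HB.instance Definition _ : EqQuotient _ rt_rel rat_tensor :=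
  EqQuotient.on rat_tensor.
HB.instance Definition _ := Choice.on rat_tensor.

Lemma rt_piP x y : \pi_rat_tensor x = \pi_rat_tensor y <->
  exists2 k : nat, (0 < k)%N &
    x.1 *~ (y.2.+1%:Z * k%:Z) = y.1 *~ (x.2.+1%:Z * k%:Z).
Proof.
split=> [/eqmodP/asboolP//|e].
by apply/eqmodP/asboolP.
Qed.

Let rt_reprP x : exists2 k : nat, (0 < k)%N &
  (repr (\pi_rat_tensor x)).1 *~ (x.2.+1%:Z * k%:Z)
  = x.1 *~ ((repr (\pi_rat_tensor x)).2.+1%:Z * k%:Z).
Proof. by apply/rt_piP; rewrite reprK. Qed.

Definition dmul (n m : nat) : nat := (n.+1 * m.+1).-1.
Arguments dmul : simpl never.

Let dmulS n m : (dmul n m).+1 = (n.+1 * m.+1)%N.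
Proof. by []. Qed.

Definition rt_add (u v : rat_tensor) : rat_tensor :=
  let: (a, n) := repr u in let: (b, m) := repr v in
  \pi_rat_tensor (a *~ m.+1%:Z + b *~ n.+1%:Z, dmul n m).
Definition rt_opp (u : rat_tensor) : rat_tensor :=
  \pi_rat_tensor (- (repr u).1, (repr u).2).
Definition rt_scale (q : rat) (u : rat_tensor) : rat_tensor :=
  \pi_rat_tensor ((repr u).1 *~ numq q, dmul (repr u).2 `|denq q|.-1).

Let den_gt0 q : (0 < `|denq q|)%N.
Proof. by rewrite absz_gt0 denq_eq0. Qed.

Let rt_addE x y :
  rt_add (\pi x) (\pi y) =
  \pi_rat_tensor (x.1 *~ y.2.+1%:Z + y.1 *~ x.2.+1%:Z, dmul x.2 y.2).
Proof.
have [k k0] := rt_reprP x; have [l l0] := rt_reprP y; rewrite /rt_add.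
case: (repr (\pi x)) => a n; case: (repr (\pi y)) => b m /= ey ex.
apply/rt_piP; exists (k * l)%N; rewrite ?muln_gt0 ?k0//= !mulrzDl -!mulrzA.
rewrite !dmulS !PoszM; congr (_ + _).
  transitivity (a *~ (x.2.+1%:Z * k%:Z) *~ (m.+1%:Z * y.2.+1%:Z * l%:Z)).
    by rewrite -mulrzA; congr (_ *~ _); ring.
  by rewrite ex -mulrzA; congr (_ *~ _); ring.
transitivity (b *~ (y.2.+1%:Z * l%:Z) *~ (n.+1%:Z * x.2.+1%:Z * k%:Z)).
  by rewrite -mulrzA; congr (_ *~ _); ring.
by rewrite ey -mulrzA; congr (_ *~ _); ring.
Qed.

Let rt_oppE x : rt_opp (\pi x) = \pi_rat_tensor (- x.1, x.2).
Proof.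
have [k k0 e] := rt_reprP x; apply/rt_piP; exists k => //=.
by rewrite !mulNrz e.
Qed.

Let rt_scaleE q x :
  rt_scale q (\pi x) = \pi_rat_tensor (x.1 *~ numq q, dmul x.2 `|denq q|.-1).
Proof.
have [k k0 e] := rt_reprP x; apply/rt_piP; exists k => //=.
rewrite !dmulS !prednK ?den_gt0// !PoszM -!mulrzA.
set a := (repr _).1 in e *; set n := (repr _).2 in e *.
transitivity (a *~ (x.2.+1%:Z * k%:Z) *~ (numq q * `|denq q|%N)).
  by rewrite -mulrzA; congr (_ *~ _); ring.
by rewrite e -mulrzA; congr (_ *~ _); ring.
Qed.

Let rt_eq (x y : A * nat) : x.1 *~ y.2.+1%:Z = y.1 *~ x.2.+1%:Z ->
  \pi_rat_tensor x = \pi_rat_tensor y.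
Proof. by move=> e; apply/rt_piP; exists 1%N; rewrite // !mulr1. Qed.

Fact rt_addA : associative rt_add.
Proof.
elim/quotW=> x; elim/quotW=> y; elim/quotW=> z; rewrite !rt_addE.
apply: rt_eq; rewrite /= !dmulS !mulrzDl -!mulrzA -!addrA !PoszM.
by do 2?[congr (_ + _)]; congr (_ *~ _); ring.
Qed.

Fact rt_addC : commutative rt_add.
Proof.
elim/quotW=> x; elim/quotW=> y; rewrite !rt_addE.
by apply: rt_eq; rewrite /= !dmulS mulnC addrC.
Qed.

Fact rt_add0 : left_id (\pi_rat_tensor (0, 0%N)) rt_add.
Proof.
elim/quotW=> x; rewrite rt_addE; apply: rt_eq; rewrite /= dmulS mul0rz add0r mulr1z mul1n.
by [].
Qed.

Fact rt_addN : left_inverse (\pi_rat_tensor (0, 0%N)) rt_opp rt_add.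
Proof.
elim/quotW=> x; rewrite rt_oppE rt_addE /=; apply: rt_eq => /=.
by rewrite mulNrz addNr !mul0rz.
Qed.

HB.instance Definition _ :=
  GRing.isZmodule.Build rat_tensor rt_addA rt_addC rt_add0 rt_addN.

Let denZ q : `|denq q|%N%:Z = denq q.
Proof. by rewrite gez0_abs// ltW. Qed.

Fact rt_scaleA q r u : rt_scale q (rt_scale r u) = rt_scale (q * r) u.
Proof.
elim/quotW: u => x; rewrite !rt_scaleE /=; apply: rt_eq => /=.
rewrite !dmulS !prednK ?den_gt0// -!mulrzA !PoszM !denZ; congr (_ *~ _).
suff e : numq r * numq q * denq (q * r) = numq (q * r) * (denq r * denq q).
  transitivity (x.2.+1%:Z * (numq r * numq q * denq (q * r))); first by ring.
  by rewrite e; ring.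
apply: (@intr_inj rat); rewrite !rmorphM /= !numqE; ring.
Qed.

Fact rt_scale1 : left_id 1 rt_scale.
Proof.
elim/quotW=> x; rewrite rt_scaleE /=; apply: rt_eq => /=.
by rewrite dmulS muln1 mulr1z.
Qed.

Fact rt_scaleDr : right_distributive rt_scale +%R.
Proof.
move=> q; elim/quotW=> x; elim/quotW=> y; rewrite [_ + _]rt_addE !rt_scaleE.
rewrite [RHS]rt_addE /=; apply: rt_eq => /=.
rewrite !dmulS !prednK ?den_gt0// !mulrzDl -!mulrzA !PoszM.
by congr (_ + _); congr (_ *~ _); ring.
Qed.

Fact rt_scaleDl u : {morph rt_scale^~ u : q r / q + r}.
Proof.
elim/quotW: u => x q r; rewrite !rt_scaleE [RHS]rt_addE /=; apply: rt_eq => /=.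
rewrite !dmulS !prednK ?den_gt0// -!mulrzA -mulrzDr -mulrzA.
rewrite !PoszM !denZ; congr (_ *~ _).
suff e : numq (q + r) * (denq q * denq r) =
         (numq q * denq r + numq r * denq q) * denq (q + r).
  transitivity (x.2.+1%:Z * x.2.+1%:Z * (numq (q + r) * (denq q * denq r))).
    by ring.
  by rewrite e; ring.
by apply: (@intr_inj rat); rewrite !(rmorphM, rmorphD) /= !numqE; ring.
Qed.

HB.instance Definition _ := GRing.Zmodule_isLmodule.Build rat rat_tensor
  rt_scaleA rt_scale1 rt_scaleDr rt_scaleDl.

(* the canonical map a |-> 1 (x) a *)
Definition rt_in (a : A) : rat_tensor := \pi_rat_tensor (a, 0%N).

Fact rt_in_zmod_morphism : zmod_morphism rt_in.
Proof.
move=> a b; rewrite -[RHS]/(rt_add (\pi_rat_tensor (a, 0%N))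
  (rt_opp (\pi_rat_tensor (b, 0%N)))) rt_oppE rt_addE.
apply: rt_eq => /=.
by rewrite dmulS !mulr1z.
Qed.

HB.instance Definition _ :=
  GRing.isZmodMorphism.Build A rat_tensor rt_in rt_in_zmod_morphism.

Lemma rt_inE x : \pi_rat_tensor x = (x.2.+1%:R)^-1 *: rt_in x.1.
Proof.
have n0 : x.2.+1%:R != 0 :> rat by rewrite pnatr_eq0.
apply: (scalerI n0); rewrite scalerA mulfV// scale1r [LHS]rt_scaleE.
apply: rt_eq; rewrite /= dmulS -[x.2.+1%:R]/(x.2.+1%:~R : rat).
by rewrite numq_int denq_int muln1 mulr1z.
Qed.

Lemma rat_tensor_univ (W : lmodType rat) (f : {additive A -> W}) :
  exists g : {linear rat_tensor -> W}, (forall a, g (rt_in a) = f a) /\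
    forall h : {linear rat_tensor -> W}, (forall a, h (rt_in a) = f a) -> h =1 g.
Proof.
pose g (u : rat_tensor) : W := ((repr u).2.+1%:R)^-1 *: f (repr u).1.
have gE x : g (\pi_rat_tensor x) = (x.2.+1%:R)^-1 *: f x.1.
  have [k k0 e] := rt_reprP x; rewrite /g.
  have nz (n : nat) : n.+1%:R != 0 :> rat by rewrite pnatr_eq0.
  have kz : k%:R != 0 :> rat by rewrite pnatr_eq0 -lt0n.
  apply: (scalerI (nz (repr (\pi_rat_tensor x)).2)).
  apply: (scalerI (nz x.2)); apply: (scalerI kz).
  rewrite !scalerA mulfK// (mulrAC _ _ (_^-1)) mulfK//.
  move/(congr1 f): e; rewrite !raddfMz -!scaler_int !rmorphM /=.
  by rewrite !(mulrC k%:R).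
have gl : linear g.
  move=> q; elim/quotW=> y; elim/quotW=> z.
  rewrite [q *: _]rt_scaleE [_ + _]rt_addE !gE /= !dmulS prednK ?den_gt0//.
  rewrite raddfD /= !raddfMz -!scaler_int.
  rewrite !scalerDr !scalerA !natrM !PoszM !intrM denZ numqE -!pmulrn.
  have y0 : y.2.+1%:R != 0 :> rat by rewrite pnatr_eq0.
  have z0 : z.2.+1%:R != 0 :> rat by rewrite pnatr_eq0.
  have q0 : (denq q)%:~R != 0 :> rat by rewrite intr_eq0 denq_eq0.
  rewrite (_ : `|denq q|%:R = (denq q)%:~R :> rat) ?natr_absz ?ger0_norm//.
  move: y0 z0 q0; set a := y.2.+1%:R; set b := z.2.+1%:R; set c := (denq q)%:~R.
  move=> a0 b0 c0.
  clearbody a b c.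
  by congr (_ *: _ + _ *: _); field; rewrite ?a0 ?b0 ?c0.
pose gL := GRing.isLinear.Build rat rat_tensor W *:%R g gl.
pose G : {linear rat_tensor -> W} := HB.pack g gL.
exists G; split=> [a|h hf].
  by rewrite [LHS]gE invr1 scale1r.
by elim/quotW=> x; rewrite [RHS]gE rt_inE linearZ /= hf.
Qed.

End RatTensor.

Section Subspace.
Variables (K : pzRingType) (V : lmodType K) (X : set V).

Definition lspan : set V := smallest (fun B : set V => submod_closed [in B]) X.

Fact lspan_submod_closed : submod_closed [in lspan].
Proof.
split=> [|a u v]; rewrite !inE.
  by move=> B [[B0 _] _]; move: B0; rewrite inE.
move=> uX vX B [[B0 BL] XB].
by have := BL a u v; rewrite !inE; apply; [exact: uX|exact: vX].
Qed.

Definition in_lspan : {pred V} := [in lspan].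

(* the linear span of X as a vector space in its own right *)
Definition Lspan : Type := {v : V | v \in in_lspan}.

HB.instance Definition _ := SubType.on Lspan.
HB.instance Definition _ := Choice.on Lspan.
HB.instance Definition _ :=
  GRing.isSubmodClosed.Build K V in_lspan lspan_submod_closed.
HB.instance Definition _ := [SubChoice_isSubLmodule of Lspan by <:].

End Subspace.

Definition basis (K : pzRingType) (V : lmodType K) (J : eqType) (e : J -> V) :=
  (forall (s : seq J) (c : J -> K), uniq s ->
     \sum_(j <- s) c j *: e j = 0 -> forall j, j \in s -> c j = 0) /\
  lspan (range e) = setT.

(* Groups of automorphisms of T are sets of functions T -> T. *)
Section AutomorphismGroups.
Variable T : Type.

Definition aut_group_closed (G : set (T -> T)) :=
  [/\ G id,
      forall g h, G g -> G h -> G (g \o h) &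
      forall g h, G g -> cancel g h -> cancel h g -> G h].

Definition generated_group (X : set (T -> T)) : set (T -> T) :=
  smallest aut_group_closed X.

Definition center (G : set (T -> T)) : set (T -> T) :=
  [set g | G g /\ forall h, G h -> g \o h = h \o g].

End AutomorphismGroups.

(* (b, a^\vee) *)
Definition coroot (T : Type) (form : T -> T -> rat) (b a : T) : rat :=
  if form a a != 0 then 2 * form b a / form a a else 0.

Definition reflection (V : lmodType rat) (form : V -> V -> rat) (a b : V) : V :=
  b - coroot form b a *: a.

(* w_{a_1} \o ... \o w_{a_k} *)
Definition reflection_product (A T : Type) (w : A -> T -> T) (s : seq A) :
  T -> T := foldr (fun a f => w a \o f) id s.

Definition torsion_free (A : zmodType) :=
  forall (a : A) (n : nat), a *+ n = 0 -> n = 0%N \/ a = 0.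

Section AffineReflectionSystems.
Variables (A : zmodType) (form : A -> A -> rat).
Implicit Types (R S B : set A) (a b : A).

Record semidefinite_form : Prop := {
  form_sym : forall a b, form a b = form b a;
  form_add : forall a b c, form (a + b) c = form a c + form b c;
  form_ge0 : forall a, 0 <= form a a;
  form_nontrivial : exists a b, form a b != 0
}.

Definition radical : set A := [set a | forall b, form a b = 0].

(* B^\times and B^0 *)
Definition nonisotropic B : set A := B `\` radical.
Definition isotropic B : set A := B `&` radical.

Definition generated_subgroup B : set A :=
  smallest (fun C : set A => zmod_closed [in C]) B.

Record affine_reflection_system R : Prop := {
  ars_opp : R = [set - a | a in R];
  ars_gen : generated_subgroup R = setT;
  ars_string : forall a b, nonisotropic R a -> R b ->
    exists d u : nat,
      range (fun n : int => b + a *~ n) `&` R =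
        [set b + a *~ n | n in [set n : int | - d%:Z <= n <= u%:Z]] /\
      d%:R - u%:R = coroot form b a
}.

Definition orthogonal_sets B C := forall b c, B b -> C c -> form b c = 0.

Definition irreducible R := ~ exists B C : set A,
  [/\ B !=set0, C !=set0, B `&` C = set0,
      nonisotropic R = B `|` C & orthogonal_sets B C].

Definition tame R := isotropic R `<=`
  [set a - b | a in nonisotropic R & b in nonisotropic R].

(* The image of R in A / A^0 is {0, e, -e} with e nonzero; subsets of A / A^0  *)
(* are compared through their preimages in A.                                  *)
Definition type_A1 R := exists e, ~ radical e /\
  [set r + c | r in R & c in radical] =
  [set r + c | r in [set 0; e; - e] & c in radical].

Record A1_presentation R (eps : A) S : Prop := {
  A1_R : R = [set s + t | s in S & t in S] `|`
             [set r + s | r in [set 0; eps; - eps] & s in S];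
  A1_S_iso : S `<=` isotropic R;
  A1_S0 : S 0;
  A1_S_closed : forall s t, S s -> S t -> S (s + t *+ 2) /\ S (s - t *+ 2);
  A1_S_gen : generated_subgroup S = radical;
  A1_dirsum : forall a, exists! n : int, radical (a - eps *~ n);
  A1_norm : form eps eps = 2
}.

(* a = sgn(a) eps + p(a) *)
Definition A1_coordinates (eps : A) (sgn : A -> int) (p : A -> A) :=
  forall a, radical (p a) /\ a = eps *~ sgn a + p a.

(* The sign of the (i+1)-st term is (-1)^(i+1) as tuples are indexed from 0.   *)
Definition Alt R (sgn : A -> int) (p : A -> A) : set (seq A) :=
  [set s : seq A | [/\ forall a, a \in s -> nonisotropic R a, ~~ odd (size s) &
     \sum_(i < size s) p s`_i *~ ((-1) ^+ i.+1 * sgn s`_i) = 0]].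

(* For a in an affine reflection system, (b, a^\vee) is an integer for all b   *)
(* in A, and the floor is only there to view it as an element of int.          *)
Definition weyl_reflection (a b : A) : A := b - a *~ Num.floor (coroot form b a).

End AffineReflectionSystems.

Section HyperbolicExtension.
Variables (A : zmodType) (form : A -> A -> rat).

(* V^0 = Q (x) A^0, as a subspace of V = Q (x) A *)
Definition V0 : Type := Lspan [set rt_in a | a in radical form].

Definition dual_family (J : eqType) (sigma : J -> V0)
    (lambda : J -> {linear V0 -> rat^o}) :=
  forall i j, lambda j (sigma i) = (i == j)%:R.

Variables (J : eqType) (lambda : J -> {linear V0 -> rat^o}).

(* the span of the lambda_j among the functions on V^0 *)
Definition V0_dagger : Type := Lspan (range (fun j => lambda j : V0 -> rat^o)).

Definition hyperbolic_space : Type := (rat_tensor A * V0_dagger)%type.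
HB.instance Definition _ := GRing.Lmodule.on hyperbolic_space.

Definition V_in (v : rat_tensor A) : hyperbolic_space := (v, 0).
Definition V0_in (v : V0) : hyperbolic_space := V_in (val v).
Definition dagger_in (f : V0_dagger) : hyperbolic_space := (0, f).
Definition A_in (a : A) : hyperbolic_space := V_in (rt_in a).

Record hyperbolic_form (eps : A) (B : {biscalar hyperbolic_space}) : Prop := {
  hform_sym : forall x y, B x y = B y x;
  hform_ext : forall a b, B (A_in a) (A_in b) = form a b;
  hform_eps : forall f, B (A_in eps) (dagger_in f) = 0;
  hform_dagger : forall f g, B (dagger_in f) (dagger_in g) = 0;
  hform_pairing : forall v f, B (V0_in v) (dagger_in f) = val f v
}.

Definition hyperbolic_reflection (B : {biscalar hyperbolic_space}) (a : A) :
  hyperbolic_space -> hyperbolic_space := reflection B (A_in a).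

Definition hyperbolic_weyl_group (B : {biscalar hyperbolic_space}) (R : set A) :=
  generated_group [set hyperbolic_reflection B a | a in R].

End HyperbolicExtension.

(* Main.v *)
(* For a nonisotropic root a, the reflection w_a maps n eps + q to             *)
(* - n eps + (q - 2 n sgn(a) p(a)), so a product of k such reflections maps it *)
(* to (-1)^k n eps + (q - 2 (-1)^k n T), where T is the alternating sum in the *)
(* definition of Alt; it is the identity on A iff k is even and T = 0.  The    *)
(* products wt in the hyperbolic Weyl group are isometries extending those on  *)
(* A, so if wt fixes V pointwise, then it commutes with every w_a because      *)
(* wt w_a wt^-1 = w_(wt a) = w_a.  Conversely, if w commutes with w_(eps + s)  *)
(* on A, comparing values at eps yields 2 (1 - (-1)^k) s = 4 (-1)^k T for all  *)
(* s in S: s = 0 gives T = 0, and a nonzero s then forces k to be even.        *)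
From HB Require Import structures.
Require Import Defs.
From mathcomp Require Import ring.
Set Implicit Arguments.
Unset Strict Implicit.
Unset Printing Implicit Defensive.
Import Order.TTheory GRing.Theory Num.Theory.
Local Open Scope classical_set_scope.
Local Open Scope ring_scope.

Section Reflections.
Variables (V : lmodType rat) (B : {biscalar V}).
Hypothesis B_sym : forall x y, B x y = B y x.
Implicit Types (a u v x y : V).

Lemma reflection_is_linear a : linear (reflection B a).
Proof.
move=> q u v; rewrite /reflection /coroot.
case: ifP => _; last by rewrite !scale0r !subr0.
rewrite linearPl /= scalerBr addrACA -opprD scalerA -scalerDl.
by congr (_ - _ *: _); ring.
Qed.

Lemma reflection_isometry a x y :
  B (reflection B a x) (reflection B a y) = B x y.
Proof.
rewrite /reflection /coroot; case: ifPn => [a0|_];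
  last by rewrite !scale0r !subr0.
rewrite !(linearBl, linearBr, linearZl_LR, linearZr_LR) /= (B_sym a y).
by field.
Qed.

Lemma isometry_reflectionC (g : V -> V) a : linear g ->
  (forall x y, B (g x) (g y) = B x y) -> g a = a ->
  g \o reflection B a = reflection B a \o g.
Proof.
move=> g_lin g_iso ga; apply/funext => x /=; rewrite /reflection /coroot.
pose gL := GRing.isLinear.Build rat V V *:%R g g_lin.
pose G : {linear V -> V} := HB.pack g gL.
rewrite -[g (_ - _)]/(G _) linearB linearZ /= -/(g _) ga.
by rewrite -(g_iso x) ga.
Qed.

Section Product.
Variables (I : Type) (f : I -> V).
Let w := reflection_product (fun i => reflection B (f i)).

Lemma reflection_product_linear s : linear (w s).
Proof.
by elim: s => [//|a s IH] q u v; rewrite /w /= [X in reflection _ _ X]IH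
  reflection_is_linear.
Qed.

Lemma reflection_product_isometry s x y : B (w s x) (w s y) = B x y.
Proof. by elim: s => [//|a s IH]; rewrite /w /= reflection_isometry. Qed.

End Product.
End Reflections.

Lemma generated_groupS (T : Type) (X : set (T -> T)) g :
  X g -> generated_group X g.
Proof. by move=> Xg G [_]; apply. Qed.

Lemma generated_group_comp (T : Type) (X : set (T -> T)) g h :
  generated_group X g -> generated_group X h -> generated_group X (g \o h).
Proof.
move=> Xg Xh G GX; have [[_ Gcomp _] _] := GX.
by apply: Gcomp; [exact: Xg|exact: Xh].
Qed.

Lemma generated_group_reflection_product (A : eqType) (T : Type)
    (w : A -> T -> T) (R : set A) (s : seq A) : (forall a, a \in s -> R a) ->
  generated_group [set w a | a in R] (reflection_product w s).
Proof.
elim: s => [_ G [[]]//|a s IH sR].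
apply: generated_group_comp; last first.
  by apply: IH => b bs; apply: sR; rewrite inE bs orbT.
by apply: generated_groupS; exists a => //; apply: sR; rewrite mem_head.
Qed.

Lemma generated_group_commute (T : Type) (X : set (T -> T)) g :
  (forall h, X h -> g \o h = h \o g) ->
  forall h, generated_group X h -> g \o h = h \o g.
Proof.
move=> gX h /(_ [set h : T -> T | g \o h = h \o g]); apply; split=> //; split=> // [h1 h2 e1 e2|h1 h2 e hK Kh].
  by rewrite /mkset compA e1 -compA e2 compA.
apply/funext => x /=; rewrite -{2}[x]Kh.
by rewrite -[g (h1 _)]/((g \o h1) _) e /= hK.
Qed.

Section RatTensor.
Variable A : zmodType.

Lemma rt_in_inj : torsion_free A -> injective (@rt_in A).
Proof.
move=> A_tf a b /rt_piP[k k0 /=]; rewrite mul1r => /eqP.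
rewrite -subr_eq0 -mulrzBl => /eqP/A_tf[k_eq0|/eqP]; first by rewrite k_eq0 in k0.
by rewrite subr_eq0 => /eqP.
Qed.

Lemma rat_tensorP (v : rat_tensor A) : exists q a, v = q *: rt_in a.
Proof.
by elim/quotW: v => x; exists (x.2.+1%:R)^-1, x.1; rewrite rt_inE.
Qed.

Lemma torsion_freeMz (a : A) (n : int) :
  torsion_free A -> n != 0 -> a *~ n = 0 -> a = 0.
Proof.
move=> A_tf; case: n => n n0 => [|/eqP].
  by case/A_tf => // n_eq0; rewrite n_eq0 in n0.
by rewrite NegzE mulrNz oppr_eq0 => /eqP/A_tf[].
Qed.

End RatTensor.

Section SemidefiniteForm.
Variables (A : zmodType) (form : A -> A -> rat).
Hypothesis form_psd : semidefinite_form form.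
Implicit Types (a b q r : A) (n m : int).

Let formD := form_add form_psd.

Lemma form0l b : form 0 b = 0.
Proof. by apply: (@addrI _ (form 0 b)); rewrite -formD !addr0. Qed.

Lemma formNl a b : form (- a) b = - form a b.
Proof. by apply: (@addrI _ (form a b)); rewrite -formD !subrr form0l. Qed.

Lemma formMzl a b n : form (a *~ n) b = n%:~R * form a b.
Proof.
have formMn k : form (a *+ k) b = k%:R * form a b.
  elim: k => [|k IH]; first by rewrite mulr0n mul0r form0l.
  by rewrite mulrSr formD IH -natr1 mulrDl mul1r.
by case: n => k; rewrite ?NegzE ?mulrNz ?formNl formMn ?mulrNz ?mulNr.
Qed.

Lemma radicalD q r : radical form q -> radical form r -> radical form (q + r).
Proof. by move=> q0 r0 b; rewrite formD q0 r0 addr0. Qed.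

Lemma radicalMz q n : radical form q -> radical form (q *~ n).
Proof. by move=> q0 b; rewrite formMzl q0 mulr0. Qed.

Lemma radicalB q r : radical form q -> radical form r -> radical form (q - r).
Proof.
move=> q0 r0; rewrite -[r]mulr1z -mulrNz.
by apply: radicalD => //; exact: radicalMz.
Qed.

End SemidefiniteForm.

Definition alternating_sum (A : zmodType) (sgn : A -> int) (p : A -> A)
    (s : seq A) : A :=
  \sum_(i < size s) p s`_i *~ ((-1) ^+ i.+1 * sgn s`_i).

Lemma alternating_sum_cons (A : zmodType) (sgn : A -> int) (p : A -> A) a s :
  alternating_sum sgn p (a :: s) = - (p a *~ sgn a + alternating_sum sgn p s).
Proof.
rewrite /alternating_sum /= big_ord_recl /= expr1 mulN1r mulrNz opprD.
rewrite -sumrN; congr (_ + _); apply: eq_bigr => i _.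
by rewrite /= /bump add1n exprS mulN1r mulNr mulrNz.
Qed.

Section TypeA1.
Variables (A : zmodType) (form : A -> A -> rat) (R : set A).
Hypothesis form_psd : semidefinite_form form.
Variables (eps : A) (S : set A).
Hypothesis R_pres : A1_presentation form R eps S.
Variables (sgn : A -> int) (p : A -> A).
Hypothesis sgn_p : A1_coordinates form eps sgn p.
Implicit Types (a b q r s : A) (n m : int).

Let formD := form_add form_psd.
Let S_radical s : S s -> radical form s.
Proof. by case/(A1_S_iso R_pres). Qed.

Lemma A1_form n m q r : radical form q -> radical form r ->
  form (eps *~ n + q) (eps *~ m + r) = (2 * n * m)%:~R.
Proof.
move=> q0 r0; rewrite formD (q0 _) addr0.
rewrite (formMzl form_psd) (form_sym form_psd).
rewrite formD (r0 _) addr0.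
by rewrite (formMzl form_psd) (A1_norm R_pres); ring.
Qed.

Lemma A1_coordE a n q : radical form q -> a = eps *~ n + q ->
  sgn a = n /\ p a = q.
Proof.
move=> q0 aE; have [pa0 aE'] := sgn_p a.
have r0 : radical form 0 by move=> b; rewrite (form0l form_psd).
have sE : sgn a = n.
  have := A1_form (sgn a) 1 pa0 r0; rewrite -aE' {1}aE A1_form// => /intr_inj.
  by rewrite !mulr1 => /mulfI-/(_ isT).
by split=> //; apply: (@addrI _ (eps *~ n)); rewrite -aE -{1}sE.
Qed.

Lemma A1_root_add s : S s -> nonisotropic form R (eps + s).
Proof.
move=> Ss; split; first by rewrite (A1_R R_pres); right; exists eps;
  [left; right|exists s].
move/(_ eps); rewrite formD (S_radical Ss) (A1_norm R_pres) addr0.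
by apply/eqP.
Qed.

Lemma A1_root_sgn a : nonisotropic form R a -> sgn a * sgn a = 1.
Proof.
case; rewrite (A1_R R_pres) => -[[s Ss [t St <-]]|[r rE [s Ss <-]]] a0.
  by case: a0; apply: radicalD => //; apply: S_radical.
have s0 := S_radical Ss; case: rE a0 => [[|]|] -> a0.
- by case: a0; rewrite add0r.
- by have [-> _] := @A1_coordE (eps + s) 1 s s0 erefl.
- by have [-> _] := @A1_coordE (- eps + s) (-1) s s0 erefl.
Qed.

Lemma A1_reflection a n q : nonisotropic form R a -> radical form q ->
  weyl_reflection form a (eps *~ n + q) =
  eps *~ (- n) + (q - p a *~ (2 * sgn a * n)).
Proof.
move=> Ra q0; have ss := A1_root_sgn Ra; have [pa0 aE] := sgn_p a.
have faa : form a a = 2 by rewrite aE A1_form// -mulrA ss.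
rewrite /weyl_reflection /coroot faa /=.
have -> : 2 * form (eps *~ n + q) a / 2 = (2 * sgn a * n)%:~R.
  by rewrite {1}aE A1_form//; field.
rewrite intrKfloor {1}aE mulrzDl -mulrzA opprD addrACA -mulrzBr.
congr (eps *~ _ + _).
by rewrite mulrA [sgn a * _]mulrCA ss; ring.
Qed.

Lemma radical_alternating_sum (l : seq A) :
  radical form (alternating_sum sgn p l).
Proof.
elim: l => [|a l IH]; first by
  rewrite /alternating_sum big_ord0 => b; exact: form0l.
rewrite alternating_sum_cons -mulrN1z; apply: (radicalMz form_psd).
by apply: (radicalD form_psd) IH; apply: (radicalMz form_psd); case: (sgn_p a).
Qed.

Lemma A1_reflection_product (l : seq A) n q :
  (forall a, a \in l -> nonisotropic form R a) -> radical form q ->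
  reflection_product (weyl_reflection form) l (eps *~ n + q) =
  eps *~ ((-1) ^+ size l * n) +
    (q - alternating_sum sgn p l *~ (2 * (-1) ^+ size l * n)).
Proof.
elim: l => [|a l IH] lR q0.
  by rewrite /alternating_sum big_ord0 mul0rz subr0 mul1r.
have Ra : nonisotropic form R a by apply: lR; rewrite mem_head.
have {}IH := IH (fun b bl => lR b (mem_behead (s := a :: l) bl)) q0.
have T0 := radical_alternating_sum l.
rewrite /= IH A1_reflection//; last first.
  by apply: (radicalB form_psd) => //; exact: (radicalMz form_psd).
rewrite alternating_sum_cons exprS -addrA; congr (eps *~ _ + (q + _));
  first by ring.
rewrite mulNrz opprK mulrzDl -mulrzA addrC -!mulrNz.
by congr (p a *~ _ + _ *~ _); ring.
Qed.

Lemma A1_reflection_product_id (l : seq A) : torsion_free A ->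
  (forall a, a \in l -> nonisotropic form R a) ->
  Alt form R sgn p l <-> reflection_product (weyl_reflection form) l = id.
Proof.
move=> A_tf lR; have T0 := radical_alternating_sum l; split=> [[_ l_even T_eq0]|w_id].
  apply/funext => a; have [pa0 {1}->] := sgn_p a.
  rewrite A1_reflection_product// -signr_odd (negPf l_even) mul1r.
  rewrite [alternating_sum _ _ _]T_eq0 mul0rz subr0.
  by case: (sgn_p a).
have r0 : radical form 0 by move=> b; exact: (form0l form_psd).
have := A1_reflection_product 1 lR r0; rewrite w_id /= add0r => epsE.
have [sgn1 p0] := A1_coordE r0 (erefl (eps *~ 1 + 0)).
have [|] := A1_coordE _ epsE.
  by rewrite -mulrNz; exact: (radicalMz form_psd).
rewrite sgn1 p0 -signr_odd; case l_odd: (odd (size l)) => // _.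
move/esym/eqP; rewrite oppr_eq0 => /eqP/(torsion_freeMz A_tf) T_eq0.
by split; rewrite ?l_odd//; exact: T_eq0.
Qed.

Lemma A1_S_neq0 : isotropic form R <> [set 0] -> exists2 s, S s & s != 0.
Proof.
move=> R_iso; apply: contrapT => S_eq0; apply: R_iso; apply/seteqP; split=> x.
  case=> _; rewrite -(A1_S_gen R_pres) => /(_ [set 0]); apply; split.
    split; first by rewrite inE.
    by move=> u v; rewrite !inE => -> ->; rewrite subr0.
  move=> s Ss; apply/eqP/negPn/negP => s0.
  by apply: S_eq0; exists s.
move=> ->; split; last by move=> b; exact: (form0l form_psd).
by rewrite (A1_R R_pres); left; exists 0; [|exists 0; rewrite ?addr0];
  rewrite //; apply: (A1_S0 R_pres).
Qed.

Lemma A1_central_Alt (l : seq A) : torsion_free A ->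
  isotropic form R <> [set 0] ->
  (forall a, a \in l -> nonisotropic form R a) ->
  let w := reflection_product (weyl_reflection form) l in
  (forall a, nonisotropic form R a ->
     w \o weyl_reflection form a = weyl_reflection form a \o w) ->
  Alt form R sgn p l.
Proof.
move=> A_tf R_iso lR w wC; have T0 := radical_alternating_sum l.
have r0 : radical form 0 by move=> b; exact: (form0l form_psd).
set T := alternating_sum sgn p l in T0; set e : int := (-1) ^+ size l.
have key s : S s -> s *~ (2 * (1 - e)) = T *~ (4 * e).
  move=> Ss; have s0 := S_radical Ss; have Rs := A1_root_add Ss.
  have [sgn_s p_s] := @A1_coordE (eps + s) 1 s s0 erefl.
  have := congr1 (fun f => f (eps *~ 1 + 0)) (wC _ Rs) => /=.
  rewrite A1_reflection// p_s sgn_s.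
  rewrite /w !A1_reflection_product//; last first.
    by rewrite -mulrNz add0r; exact: (radicalMz form_psd).
  rewrite A1_reflection//; last first.
    by rewrite -mulrNz add0r; exact: (radicalMz form_psd).
  rewrite p_s sgn_s -/e -/T !mulr1 !sub0r !mulrN1 -mulrNz.
  move/addrI; rewrite !mulrNz opprK => E.
  rewrite (_ : 2 * (1 - e) = 2 - 2 * e); last by ring.
  rewrite (_ : 4 * e = 2 * e + 2 * e); last by ring.
  rewrite mulrzBr [T *~ _]mulrzDr.
  transitivity (s *~ 2 + (T *~ (2 * e) + (- (T *~ (2 * e)) - s *~ (2 * e)))).
    by rewrite (addrA (T *~ _)) subrr add0r.
  by rewrite -E [T *~ _ + (_ + _)]addrCA (addrA (s *~ 2)) subrr add0r.
have T_eq0 : T = 0.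
  have := key 0 (A1_S0 R_pres); rewrite mul0rz => /esym/(torsion_freeMz A_tf); apply.
  by rewrite /e mulf_neq0// signr_eq0.
split=> //; have [s Ss s0] := A1_S_neq0 R_iso.
apply/negP => l_odd; case/eqP: s0; apply: (@torsion_freeMz _ _ (2 * (1 - e)) A_tf) => //.
  by rewrite /e -signr_odd l_odd.
by rewrite key// T_eq0 mul0rz.
Qed.
End TypeA1.

Section HyperbolicReflections.
Variables (A : zmodType) (form : A -> A -> rat) (R : set A).
Hypotheses (A_tf : torsion_free A) (form_psd : semidefinite_form form).
Variables (eps : A) (S : set A).
Hypothesis R_pres : A1_presentation form R eps S.
Variables (sgn : A -> int) (p : A -> A).
Hypothesis sgn_p : A1_coordinates form eps sgn p.
Variables (J : eqType) (lambda : J -> {linear V0 form -> rat^o}).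
Variable formt : {biscalar hyperbolic_space lambda}.
Hypothesis formt_hyp : hyperbolic_form eps formt.

Lemma A_in_inj : injective (@A_in A form J lambda).
Proof. by move=> a b [/(rt_in_inj A_tf)]. Qed.

Lemma hyperbolic_reflection_A_in a b : nonisotropic form R a ->
  hyperbolic_reflection formt a (A_in lambda b) =
  A_in lambda (weyl_reflection form a b).
Proof.
move=> Ra; have ss := A1_root_sgn form_psd R_pres sgn_p Ra.
have [pa0 aE] := sgn_p a; have [pb0 bE] := sgn_p b.
rewrite /hyperbolic_reflection /reflection /coroot !(hform_ext formt_hyp).
rewrite /weyl_reflection /coroot.
have -> : form a a = 2 by rewrite aE (A1_form form_psd R_pres)// -mulrA ss.
have -> : 2 * form b a / 2 = (2 * sgn b * sgn a)%:~R.
  by rewrite {1}bE {1}aE (A1_form form_psd R_pres)//; field.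
rewrite /= intrKfloor /A_in /V_in raddfB raddfMz /= -scaler_int.
by apply: (congr2 pair); rewrite //= scaler0 subr0.
Qed.

Lemma hyperbolic_reflection_product_A_in (l : seq A) b :
  (forall a, a \in l -> nonisotropic form R a) ->
  reflection_product (hyperbolic_reflection formt) l (A_in lambda b) =
  A_in lambda (reflection_product (weyl_reflection form) l b).
Proof.
elim: l => [//|a l IH] lR /=; rewrite IH => [|c cl].
  by rewrite hyperbolic_reflection_A_in//; apply: lR; rewrite mem_head.
by apply: lR; rewrite inE cl orbT.
Qed.

Lemma hyperbolic_reflection_product_V_in (l : seq A) :
  (forall a, a \in l -> nonisotropic form R a) ->
  reflection_product (weyl_reflection form) l = id <->
  forall v, reflection_product (hyperbolic_reflection formt) l (V_in lambda v) =
    V_in lambda v.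
Proof.
move=> lR; split=> [w_id v|wt_id].
  have [q [a ->]] := rat_tensorP v.
  have -> : V_in lambda (q *: rt_in a) = q *: A_in lambda a + 0.
    by apply: (congr2 pair); rewrite /= ?addr0// scaler0.
  have wt_lin := reflection_product_linear formt (@A_in A form J lambda) l.
  have wt0 : reflection_product (hyperbolic_reflection formt) l 0 = 0.
    by have := wt_lin (-1) 0 0; rewrite scaler0 addr0 scaleN1r addNr.
  by rewrite wt_lin wt0 hyperbolic_reflection_product_A_in// w_id.
apply/funext => a; apply: A_in_inj.
by rewrite -hyperbolic_reflection_product_A_in// wt_id.
Qed.
End HyperbolicReflections.

Theorem proposition3p9 (A : zmodType) (form : A -> A -> rat) (R : set A)
  (A_tf : torsion_free A) (form_psd : semidefinite_form form)
  (R_ars : affine_reflection_system form R) (R_irr : irreducible form R)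
  (R_tame : tame form R) (R_A1 : type_A1 form R)
  (R_iso : isotropic form R <> [set 0])
  (eps : A) (S : set A) (R_pres : A1_presentation form R eps S)
  (sgn : A -> int) (p : A -> A) (sgn_p : A1_coordinates form eps sgn p)
  (J : eqType) (sigma : J -> V0 form)
  (sigma_S : forall j, exists2 s, S s & val (sigma j) = rt_in s)
  (sigma_basis : basis sigma)
  (lambda : J -> {linear V0 form -> rat^o})
  (lambda_dual : dual_family sigma lambda)
  (formt : {biscalar hyperbolic_space lambda})
  (formt_hyp : hyperbolic_form eps formt)
  (alphas : seq A) (alphasP : forall a, a \in alphas -> nonisotropic form R a) :
  let w := reflection_product (weyl_reflection form) in
  let wt := reflection_product (hyperbolic_reflection formt) in
  [<-> (* (i) *) Alt form R sgn p alphas;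
       (* (ii) *) w alphas = id;
       (* (ii), on V *) forall v, wt alphas (V_in lambda v) = V_in lambda v;
       (* (iii) *) forall betas : seq A,
         (forall b, b \in betas -> nonisotropic form R b) ->
         wt alphas = wt betas -> Alt form R sgn p betas;
       (* (iv) *) center (hyperbolic_weyl_group formt R) (wt alphas)].
Proof.

move=> w wt.
have AltP l : (forall a, a \in l -> nonisotropic form R a) ->
    Alt form R sgn p l <-> w l = id.
  exact: (A1_reflection_product_id form_psd R_pres sgn_p A_tf).
have idP l : (forall a, a \in l -> nonisotropic form R a) ->
    w l = id <-> forall v, wt l (V_in lambda v) = V_in lambda v.
  exact: (hyperbolic_reflection_product_V_in A_tf form_psd R_pres sgn_p formt_hyp).
tfae.
- by move/(AltP _ alphasP).
- by move/(idP _ alphasP).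
- move=> wt_id betas betasR wtE; apply/(AltP _ betasR)/(idP _ betasR) => v.
  by rewrite -wtE.
- move=> /(_ _ alphasP erefl)/(AltP _ alphasP)/(idP _ alphasP) wt_id.
  split.
    by apply: generated_group_reflection_product => a /alphasP[].
  apply: generated_group_commute => _ [a Ra <-].
  apply: isometry_reflectionC (wt_id _).
    exact: reflection_product_linear.
  exact: (reflection_product_isometry (hform_sym formt_hyp)).
- case=> _ wtC; apply: (A1_central_Alt form_psd R_pres sgn_p) => // a Ra.
  apply/funext => b; apply: (A_in_inj A_tf (lambda := lambda)).
  have wt_A := hyperbolic_reflection_product_A_in form_psd R_pres sgn_p formt_hyp.
  have r_A := hyperbolic_reflection_A_in form_psd R_pres sgn_p formt_hyp.
  rewrite /= -wt_A// -!r_A// -wt_A//.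
  apply: (congr1 (fun f => f (A_in lambda b)) (wtC _ _)).
  by apply: generated_groupS; exists a => //; case: Ra.
Qed.
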